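(* Let $F$ be a field, $X$ an indeterminate over $F$, and for each $n\in\mathbb{N}_0$ let $R_n=F[X^{\frac{1}{2^n}}]$ and $D_n=F[X^{\frac{1}{2^n}},X^{-\frac{1}{2^n}}]$; let $D=\bigcup_{n\in\mathbb{N}_0}D_n$. For a fixed $n\in\mathbb{N}_0$, let $f(X^{\frac{1}{2^n}})$ be an irreducible element of $R_n$ with $f(0)\neq 0$. Then the following statements are equivalent. (1) $f(X^{\frac{1}{2^n}})$ is a prime element of $D$. (2) $f(X^{\frac{1}{2^n}})$ is an irreducible element of $D$. (3) $f(X^4)$ is an irreducible element of $F[X]$. (4) $f(X^{\frac{1}{2^k}})$ is a prime element of $D$ for all $k\in\mathbb{N}_0$. Hence, $D$ has no irreducible element if and only if $f(X^4)$ is not irreducible in $F[X]$ for each irreducible polynomial $f(X)$ of $F[X]$.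
   Context: $\mathbb{N}_0$ is the set of nonnegative integers. The elements $X^{1/2^n}$ are compatible roots of $X$, i.e. $(X^{1/2^{n+1}})^2=X^{1/2^n}$, so $D_n\subsetneq D_{n+1}$. Here $f$ is a polynomial in one variable over $F$, and $f(X^{1/2^k})$, $f(X^4)$ denote the results of substituting $X^{1/2^k}$, $X^4$ for its variable; $f(0)\neq 0$ means that its constant term is nonzero. *)

(* Defs.v *)
From HB Require Import structures.
From mathcomp Require Import all_boot all_order all_algebra.
Set Implicit Arguments.
Unset Strict Implicit.
Unset Printing Implicit Defensive.
Import GRing.Theory.
Local Open Scope ring_scope.
Local Open Scope quotient_scope.

(* Subrings of a commutative ring A are given by their (Prop-valued)
   membership predicate; units, divisibility, irreducible and prime elements
   are all relative to the subring S. *)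

Definition unit_in (A : comNzRingType) (S : A -> Prop) (u : A) : Prop :=
  S u /\ exists2 v, S v & u * v = 1.

Definition dvd_in (A : comNzRingType) (S : A -> Prop) (a b : A) : Prop :=
  exists2 c, S c & b = a * c.

Definition irreducible_in (A : comNzRingType) (S : A -> Prop) (a : A) : Prop :=
  [/\ S a, a <> 0, ~ unit_in S a &
    forall b c, S b -> S c -> a = b * c -> unit_in S b \/ unit_in S c].

Definition prime_in (A : comNzRingType) (S : A -> Prop) (a : A) : Prop :=
  [/\ S a, a <> 0, ~ unit_in S a &
    forall b c, S b -> S c -> dvd_in S a (b * c) ->
      dvd_in S a b \/ dvd_in S a c].

(* A field F is embedded by iota in a field L containing X = r 0 together with
   the compatible roots r n = X^(1/2^n). *)

Definition root_tower (F L : fieldType) (iota : {rmorphism F -> L})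
    (r : nat -> L) : Prop :=
  ~ algebraicOver iota (r 0%N) /\ forall n, r n.+1 ^+ 2 = r n.

Definition subst (F L : fieldType) (iota : {rmorphism F -> L})
    (f : {poly F}) (x : L) : L := (map_poly iota f).[x].

(* R_n = F[X^(1/2^n)] *)
Definition Rring (F L : fieldType) (iota : {rmorphism F -> L}) (r : nat -> L)
    (n : nat) (z : L) : Prop :=
  exists p : {poly F}, z = subst iota p (r n).

(* D_n = F[X^(1/2^n), X^(-1/2^n)]: the values of the polynomials in two
   variables over F at (X^(1/2^n), X^(-1/2^n)). *)
Definition Dring (F L : fieldType) (iota : {rmorphism F -> L}) (r : nat -> L)
    (n : nat) (z : L) : Prop :=
  exists p : {poly {poly F}},
    z = (map_poly (map_poly iota) p).[r n, (r n)^-1].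

Definition Dunion (F L : fieldType) (iota : {rmorphism F -> L})
    (r : nat -> L) (z : L) : Prop :=
  exists n, Dring iota r n z.

(* Every field F has an extension with a root_tower (root_tower_exists): the
   fraction field of the direct limit of the rings F[X^(1/2^n)], in which the
   pair (n, p) stands for p(X^(1/2^n)). *)

Definition pow2 (F : fieldType) (m : nat) (p : {poly F}) : {poly F} :=
  p \Po 'X^(2 ^ m).

HB.instance Definition _ (F : fieldType) (m : nat) :=
  GRing.RMorphism.copy (@pow2 F m) (comp_poly ('X^(2 ^ m) : {poly F})).

Lemma pow2_comp (F : fieldType) m n (p : {poly F}) :
  pow2 m (pow2 n p) = pow2 (m + n) p.
Proof.
by rewrite /pow2 -comp_polyA comp_Xn_poly -exprM -expnD.
Qed.

Lemma pow2_eq0 (F : fieldType) m (p : {poly F}) : (pow2 m p == 0) = (p == 0).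
Proof.
apply: comp_poly_eq0.
by rewrite size_polyXn ltnS expn_gt0.
Qed.

Lemma pow2_inj (F : fieldType) m : injective (@pow2 F m).
Proof.
move=> p q /eqP; rewrite -subr_eq0 -rmorphB /= pow2_eq0 subr_eq0.
by move/eqP.
Qed.

Definition dlim_rel (F : fieldType) : rel (nat * {poly F}) :=
  fun a b => pow2 b.1 a.2 == pow2 a.1 b.2.

Lemma dlim_refl (F : fieldType) : reflexive (@dlim_rel F).
Proof. by move=> a; exact: eqxx. Qed.

Lemma dlim_sym (F : fieldType) : symmetric (@dlim_rel F).
Proof. by move=> a b; rewrite /dlim_rel eq_sym. Qed.

Lemma dlim_trans (F : fieldType) : transitive (@dlim_rel F).
Proof.
move=> b a c /eqP ab /eqP bc; apply/eqP; apply: (@pow2_inj _ b.1).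
by rewrite !pow2_comp addnC -pow2_comp ab pow2_comp addnC -pow2_comp bc
  !pow2_comp addnC.
Qed.

Canonical dlim_equiv (F : fieldType) :=
  EquivRel (@dlim_rel F) (@dlim_refl F) (@dlim_sym F) (@dlim_trans F).

Definition dlim (F : fieldType) := {eq_quot (@dlim_rel F)}.

HB.instance Definition _ (F : fieldType) : EqQuotient _ (@dlim_rel F) (dlim F) :=
  EqQuotient.on (dlim F).
HB.instance Definition _ (F : fieldType) := Choice.on (dlim F).

Definition inlim (F : fieldType) n (p : {poly F}) : dlim F := \pi_(dlim F) (n, p).

Lemma inlim_eq (F : fieldType) m n (p q : {poly F}) :
  inlim m p = inlim n q <-> pow2 n p = pow2 m q.
Proof.
split=> [/eqmodP/eqP // | e].
by apply/eqmodP/eqP.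
Qed.

Lemma inlim_pow2 (F : fieldType) m n (p : {poly F}) :
  inlim (m + n) (pow2 m p) = inlim n p.
Proof. by apply/inlim_eq; rewrite !pow2_comp addnC. Qed.

Lemma inlim_ind (F : fieldType) (P : dlim F -> Prop) :
  (forall n p, P (inlim n p)) -> forall x, P x.
Proof. by move=> H x; rewrite -[x]reprK; case: (repr x). Qed.

Lemma inlim_ind2 (F : fieldType) (P : dlim F -> dlim F -> Prop) :
  (forall n p q, P (inlim n p) (inlim n q)) -> forall x y, P x y.
Proof.
move=> H; elim/inlim_ind=> m p; elim/inlim_ind=> n q.
by rewrite -(inlim_pow2 n m p) -(inlim_pow2 m n q) addnC.
Qed.

Lemma inlim_ind3 (F : fieldType) (P : dlim F -> dlim F -> dlim F -> Prop) :
  (forall n p q s, P (inlim n p) (inlim n q) (inlim n s)) ->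
  forall x y z, P x y z.
Proof.
move=> H; apply: inlim_ind2 => m p q; elim/inlim_ind=> n s.
by rewrite -(inlim_pow2 n m p) -(inlim_pow2 n m q) -(inlim_pow2 m n s) addnC.
Qed.

Definition dlim_op (F : fieldType) (op : {poly F} -> {poly F} -> {poly F})
    (x y : dlim F) : dlim F :=
  let a := repr x in let b := repr y in
  inlim (a.1 + b.1) (op (pow2 b.1 a.2) (pow2 a.1 b.2)).

Lemma dlim_opE (F : fieldType) (op : {poly F} -> {poly F} -> {poly F}) :
  (forall m, {morph pow2 m : p q / op p q}) ->
  forall n p q, dlim_op op (inlim n p) (inlim n q) = inlim n (op p q).
Proof.
move=> opM n p q; rewrite /dlim_op.
have: inlim (repr (inlim n p)).1 (repr (inlim n p)).2 = inlim n p.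
  by rewrite /inlim -surjective_pairing reprK.
have: inlim (repr (inlim n q)).1 (repr (inlim n q)).2 = inlim n q.
  by rewrite /inlim -surjective_pairing reprK.
case: (repr _) => m q' /=; case: (repr _) => k p' /= /inlim_eq eq /inlim_eq ep.
apply/inlim_eq; rewrite !opM !pow2_comp; congr op.
- by rewrite addnC -pow2_comp ep pow2_comp addnC.
- by rewrite addnC -pow2_comp eq pow2_comp.
Qed.

Definition dlim_add (F : fieldType) := dlim_op (fun p q : {poly F} => p + q).
Definition dlim_mul (F : fieldType) := dlim_op (fun p q : {poly F} => p * q).
Definition dlim_opp (F : fieldType) (x : dlim F) : dlim F :=
  inlim (repr x).1 (- (repr x).2).

Lemma dlim_addE (F : fieldType) n (p q : {poly F}) :
  dlim_add (inlim n p) (inlim n q) = inlim n (p + q).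
Proof. by apply: dlim_opE => m a b; rewrite rmorphD. Qed.

Lemma dlim_mulE (F : fieldType) n (p q : {poly F}) :
  dlim_mul (inlim n p) (inlim n q) = inlim n (p * q).
Proof. by apply: dlim_opE => m a b; rewrite rmorphM. Qed.

Lemma inlim0 (F : fieldType) n : inlim n (0 : {poly F}) = inlim 0 0.
Proof. by apply/inlim_eq; rewrite !rmorph0. Qed.

Lemma inlim1 (F : fieldType) n : inlim n (1 : {poly F}) = inlim 0 1.
Proof. by apply/inlim_eq; rewrite !rmorph1. Qed.

Lemma dlim_addA (F : fieldType) : associative (@dlim_add F).
Proof. by apply: inlim_ind3 => n p q s; rewrite !dlim_addE addrA. Qed.

Lemma dlim_addC (F : fieldType) : commutative (@dlim_add F).
Proof. by apply: inlim_ind2 => n p q; rewrite !dlim_addE addrC. Qed.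

Lemma dlim_add0 (F : fieldType) : left_id (inlim 0 0) (@dlim_add F).
Proof. by elim/inlim_ind => n p; rewrite -(inlim0 F n) dlim_addE add0r. Qed.

Lemma dlim_addN (F : fieldType) : left_inverse (inlim 0 0) (@dlim_opp F) (@dlim_add F).
Proof.
move=> x; rewrite -{2}[x]reprK /dlim_opp; case: (repr x) => n p /=.
by rewrite -/(inlim n p) dlim_addE addNr inlim0.
Qed.

HB.instance Definition _ (F : fieldType) :=
  GRing.isZmodule.Build (dlim F) (@dlim_addA F) (@dlim_addC F) (@dlim_add0 F)
    (@dlim_addN F).

Lemma dlim_mulA (F : fieldType) : associative (@dlim_mul F).
Proof. by apply: inlim_ind3 => n p q s; rewrite !dlim_mulE mulrA. Qed.

Lemma dlim_mulC (F : fieldType) : commutative (@dlim_mul F).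
Proof. by apply: inlim_ind2 => n p q; rewrite !dlim_mulE mulrC. Qed.

Lemma dlim_mul1 (F : fieldType) : left_id (inlim 0 1) (@dlim_mul F).
Proof. by elim/inlim_ind => n p; rewrite -(inlim1 F n) dlim_mulE mul1r. Qed.

Lemma dlim_mulD (F : fieldType) : left_distributive (@dlim_mul F) (@dlim_add F).
Proof.
by apply: inlim_ind3 => n p q s; rewrite !(dlim_mulE, dlim_addE) mulrDl.
Qed.

Lemma dlim_10 (F : fieldType) : inlim 0 1 != inlim 0 0 :> dlim F.
Proof.
by apply/eqP => /inlim_eq/eqP; rewrite rmorph0 pow2_eq0 oner_eq0.
Qed.

HB.instance Definition _ (F : fieldType) :=
  GRing.Zmodule_isComNzRing.Build (dlim F) (@dlim_mulA F) (@dlim_mulC F)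
    (@dlim_mul1 F) (@dlim_mulD F) (@dlim_10 F).

Lemma inlimD (F : fieldType) n (p q : {poly F}) :
  inlim n p + inlim n q = inlim n (p + q).
Proof. exact: dlim_addE. Qed.

Lemma inlimM (F : fieldType) n (p q : {poly F}) :
  inlim n p * inlim n q = inlim n (p * q).
Proof. exact: dlim_mulE. Qed.

Definition dlim_unit : forall F : fieldType, pred (dlim F) :=
  fun F x => (repr x).2 \is a GRing.unit.
Definition dlim_inv (F : fieldType) (x : dlim F) : dlim F :=
  inlim (repr x).1 ((repr x).2)^-1.

Lemma pow2_unit (F : fieldType) m (p : {poly F}) :
  pow2 m p \is a GRing.unit -> p \is a GRing.unit.
Proof.
move=> u; have p0 : p != 0.
  by apply: contraTneq u => ->; rewrite rmorph0 unitr0.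
have : (size (pow2 m p)).-1 = 0%N by case/andP: u => /eqP->.
rewrite size_comp_poly size_polyXn => /eqP.
rewrite muln_eq0 [_ == 0 in X in _ || X]eqn0Ngt expn_gt0 orbF => s.
have /size_poly1P[c c0 ->] : size p == 1%N.
  by rewrite -(prednK (_ : 0 < size p)%N) ?size_poly_gt0 // (eqP s).
by rewrite poly_unitE size_polyC c0 coefC /= unitfE.
Qed.

Lemma dlim_mulV (F : fieldType) :
  {in @dlim_unit F, left_inverse 1 (@dlim_inv F) *%R}.
Proof.
move=> x; rewrite unfold_in /dlim_unit /dlim_inv => u.
have {3}-> : x = inlim (repr x).1 (repr x).2.
  by rewrite /inlim -surjective_pairing reprK.
by rewrite inlimM mulVr // inlim1.
Qed.

Lemma dlim_unitP (F : fieldType) (x y : dlim F) : y * x = 1 -> dlim_unit x.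
Proof.
rewrite /dlim_unit -{1}[x]reprK; case: (repr x) => n p /=.
elim/inlim_ind: y => m q; rewrite -/(inlim n p).
rewrite -(inlim_pow2 m n p) -(inlim_pow2 n m q) addnC inlimM => /inlim_eq.
rewrite rmorphM rmorph1 /= !pow2_comp => e.
apply: (@pow2_unit _ (0 + m)).
by apply/unitrP; exists (pow2 (0 + n) q); rewrite e mulrC e.
Qed.

Lemma dlim_inv_out (F : fieldType) :
  {in [predC @dlim_unit F], @dlim_inv F =1 id}.
Proof.
move=> x; rewrite inE /= unfold_in /dlim_unit /dlim_inv => u.
by rewrite invr_out // /inlim -surjective_pairing reprK.
Qed.

HB.instance Definition _ (F : fieldType) :=
  GRing.ComNzRing_hasMulInverse.Build (dlim F) (@dlim_mulV F) (@dlim_unitP F)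
    (@dlim_inv_out F).

Lemma inlim_eq0 (F : fieldType) n (p : {poly F}) : (inlim n p == 0) = (p == 0).
Proof.
apply/eqP/eqP => [|->]; last exact: inlim0.
by move/inlim_eq/eqP; rewrite rmorph0 pow2_eq0 => /eqP.
Qed.

Lemma dlim_integral (F : fieldType) (x y : dlim F) :
  x * y = 0 -> (x == 0) || (y == 0).
Proof.
move: x y; apply: inlim_ind2 => n p q /eqP.
by rewrite inlimM !inlim_eq0 mulf_eq0.
Qed.

HB.instance Definition _ (F : fieldType) :=
  GRing.ComUnitRing_isIntegral.Build (dlim F) (@dlim_integral F).

Lemma inlim_monoid (F : fieldType) n :
  monoid_morphism (@inlim F n).
Proof. by split=> [|p q]; rewrite ?inlim1 ?inlimM. Qed.

Lemma inlim_additive (F : fieldType) n :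
  nmod_morphism (@inlim F n).
Proof. by split=> [|p q]; rewrite ?inlim0 ?inlimD. Qed.

HB.instance Definition _ (F : fieldType) n :=
  GRing.isNmodMorphism.Build {poly F} (dlim F) (@inlim F n) (@inlim_additive F n).
HB.instance Definition _ (F : fieldType) n :=
  GRing.isMonoidMorphism.Build {poly F} (dlim F) (@inlim F n) (@inlim_monoid F n).

Lemma root_tower_exists (F : fieldType) :
  exists (L : fieldType) (iota : {rmorphism F -> L}) (r : nat -> L),
    root_tower iota r.
Proof.
pose g : {rmorphism {poly F} -> {fraction (dlim F)}} :=
  @tofrac (dlim F) \o @inlim F 0.
exists {fraction (dlim F)}, (g \o polyC), (fun n => tofrac (inlim n 'X)).
split=> [[p p0] | n]; last first.
  rewrite -rmorphXn -rmorphXn /=; congr tofrac; apply/inlim_eq.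
  by rewrite /pow2 comp_polyX comp_Xn_poly -exprM -expnSr.
rewrite /root -[tofrac _]/(g 'X) map_poly_comp horner_map /= -/(p \Po 'X).
by rewrite comp_polyXr tofrac_eq0 inlim_eq0 (negPf p0).
Qed.

(* Main.v *)
(* Every element of [D] is, up to a power of some [X^(1/2^n)], a polynomial in
   [X^(1/2^n)], and such a polynomial with nonzero constant term is a unit of [D]
   only if it is constant. Passing from level [n] to level [m + n] replaces [f]
   by [f(X^(2^m))]. So irreducibility of [f(X^(1/2^n))] in [D] forces every
   [f(X^(2^m))] to be irreducible over [F]; conversely, if all of them are
   irreducible, Euclid's lemma at a sufficiently high level makes every
   [f(X^(1/2^k))] prime in [D]. What links this to [f(X^4)] alone is the instance
   of Capelli's theorem saying that irreducibility of [f(X^4)] implies that of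
   [f(X^8)], hence inductively that of every [f(X^(2^m))]. *)

Require Import Defs.
From mathcomp Require Import all_boot all_order all_algebra.
From mathcomp Require Import ring.
Set Implicit Arguments.
Unset Strict Implicit.
Unset Printing Implicit Defensive.
Import GRing.Theory.
Local Open Scope ring_scope.

(** * Even and odd parts of polynomials *)

Lemma even_poly_X2 (R : nzSemiRingType) (p q : {poly R}) :
  even_poly ((p \Po 'X^2) + (q \Po 'X^2) * 'X) = p.
Proof.
apply/polyP => i; rewrite coef_even_poly coefD coefMX !coef_comp_poly_Xn //.
rewrite !dvdn2 odd_double /= -mul2n mulKn //.
by case: i => [|i]; rewrite ?addr0 // mulnS /= mul2n odd_double addr0.
Qed.

Lemma odd_poly_X2 (R : nzSemiRingType) (p q : {poly R}) :
  odd_poly ((p \Po 'X^2) + (q \Po 'X^2) * 'X) = q.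
Proof.
apply/polyP => i; rewrite coef_odd_poly coefD coefMX !coef_comp_poly_Xn //.
by rewrite !dvdn2 /= odd_double /= -mul2n mulKn // add0r.
Qed.

(** [F[X]] is free over [F[X^2]] with basis [1], [X], and multiplication by [g(X^2)] acts on the two
    coordinates separately. *)
Lemma dvdp_comp_X2 (F : fieldType) (g p q : {poly F}) :
  g \Po 'X^2 %| (p \Po 'X^2) + (q \Po 'X^2) * 'X -> (g %| p) && (g %| q).
Proof.
case/dvdpP => c; rewrite -[c]poly_even_odd.
set a := even_poly c; set b := odd_poly c.
have -> : (a \Po 'X^2 + (b \Po 'X^2) * 'X) * (g \Po 'X^2) =
    ((a * g) \Po 'X^2) + ((b * g) \Po 'X^2) * 'X.
  by rewrite !comp_polyM; ring.
move=> e; rewrite -(even_poly_X2 p q) -{2}(odd_poly_X2 p q) e.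
by rewrite even_poly_X2 odd_poly_X2 !dvdp_mull.
Qed.

Lemma comp_X2_oppX (R : comNzRingType) (p : {poly R}) :
  (p \Po 'X^2) \Po (- 'X) = p \Po 'X^2.
Proof. by rewrite -comp_polyA comp_Xn_poly sqrrN. Qed.

(** * Irreducibility and substitution of powers of [X] *)

Lemma irreducible_comp (R : idomainType) (p q : {poly R}) :
  (1 < size q)%N -> irreducible_poly (p \Po q) -> irreducible_poly p.
Proof.
move=> q1 [s1 irr]; split=> [|d d1 dp].
  rewrite ltnNge; apply: contraL s1 => /size1_polyC ->.
  by rewrite comp_polyC -leqNgt size_polyC leq_b1.
have p0 : p != 0.
  by apply: contraTneq s1 => ->; rewrite comp_poly0 size_poly0.
have d0 : d != 0 by apply: contraTneq dp => ->; rewrite dvd0p.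
have sd (u : {poly R}) : u != 0 ->
    size (u \Po q) = ((size u).-1 * (size q).-1).+1.
  move=> u0; rewrite -size_comp_poly prednK // size_poly_gt0 comp_poly_eq0 //.
have q1' : (0 < (size q).-1)%N by rewrite -ltnS prednK // (ltn_trans _ q1).
have pd : (0 < size d)%N by rewrite size_poly_gt0.
have pp : (0 < size p)%N by rewrite size_poly_gt0.
(* Composition with [q] multiplies degrees by [deg q > 0], so this association forces [d] and [p] to
   have the same degree. *)
have : d \Po q %= p \Po q.
  apply: irr (dvdp_comp_poly q dp); rewrite sd // eqSS muln_eq0 negb_or -lt0n.
  by rewrite -(lt0n (size q).-1) q1' andbT -ltnS prednK // ltn_neqAle eq_sym d1.
move/eqp_size; rewrite !sd // => /succn_inj/eqP; rewrite eqn_pmul2r // => /eqP e.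
by rewrite -dvdp_size_eqp // -(prednK pd) e prednK.
Qed.

(** If [p(0) = 0], then [X] divides [p(X^n)], whose degree is a multiple of [n > 1], so that the two
    are not associate. *)
Lemma irreducible_comp_Xn_neq0 (R : idomainType) (p : {poly R}) n :
  (1 < n)%N -> irreducible_poly (p \Po 'X^n) -> p.[0] != 0.
Proof.
move=> n1 irr; apply/negP => p0.
have /(irr.2 'X) : size ('X : {poly R}) != 1%N by rewrite size_polyX.
rewrite -[X in X %| _]subr0 -polyC0 dvdp_XsubCl root_comp hornerXn expr0n.
case: n n1 irr => // n n1 irr /(_ p0) /eqp_size; rewrite size_polyX => e.
have := size_comp_poly p 'X^(n.+1); rewrite -e size_polyXn /= => /esym/eqP.
by rewrite muln_eq1 => /andP[_ /eqP n0]; rewrite n0 in n1.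
Qed.

(* The polynomial [A^2 - X B^2] is the norm of a factor [A(X^2) + X B(X^2)] of
   [p(X^2)]; if that factor is proper then [p] divides the norm but not [B], so
   [A / B] is a square root of [X] modulo [p]. *)
Lemma irreducible_comp_X2 (F : fieldType) (p : {poly F}) :
  irreducible_poly p -> (forall s, ~~ (p %| 'X - s ^+ 2)) ->
  irreducible_poly (p \Po 'X^2).
Proof.
move=> irr nsq; have p1 := irr.1; have p0 := irredp_neq0 irr.
have sX2 : (1 < size ('X^2 : {poly F}))%N by rewrite size_polyXn.
have pX0 : p \Po 'X^2 != 0 by rewrite comp_poly_eq0.
split=> [|q q1 qp].
  have := size_comp_poly p 'X^2; rewrite size_polyXn /=.
  case: (size p) p1 => [|[|m]] //= _; case: (size _) => [|[|k]] //=.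
rewrite -dvdp_size_eqp // eqn_leq dvdp_leq // leqNgt; apply/negP => lt_qp.
have q0 : q != 0 by apply: contraTneq qp => ->; rewrite dvd0p.
set A := even_poly q; set B := odd_poly q; pose N := A ^+ 2 - 'X * B ^+ 2.
have qE : q = A \Po 'X^2 + (B \Po 'X^2) * 'X by rewrite poly_even_odd.
have NE : N \Po 'X^2 = q * (q \Po - 'X).
  rewrite {1 2}qE [X in _ * X]comp_polyD [in RHS]comp_polyM !comp_X2_oppX.
  rewrite comp_polyX.
  rewrite /N comp_polyB [('X * _) \Po _]comp_polyM comp_polyX !rmorphXn /=; ring.
have q'p : q \Po - 'X %| p \Po 'X^2.
  by rewrite -(comp_X2_oppX p) dvdp_comp_poly.
(* Both [q] and [q(-X)] divide the even polynomial [p(X^2)], so [N(X^2)] divides its square. *)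
have Np : N %| p ^+ 2.
  have /andP[] // : (N %| p ^+ 2) && (N %| 0).
  apply: dvdp_comp_X2; rewrite comp_poly0 mul0r addr0 NE rmorphXn expr2.
  by rewrite dvdp_mul.
(* If [p] does not divide [N], then [N] is a unit, being a divisor of [p ^+ 2] coprime to it; hence
   so is [q]. *)
have [pN|pN] := boolP (p %| N); last first.
  have cop : coprimep N (p ^+ 2).
    by rewrite coprimep_pexpr // coprimep_sym irreducible_poly_coprime.
  have : N \Po 'X^2 %| 1.
    by rewrite -[1](comp_polyC 1 'X^2) dvdp_comp_poly // -(Gauss_dvdpr _ cop) mulr1.
  rewrite NE => /(dvdp_trans (dvdp_mulr _ (dvdpp q))).
  by rewrite dvdp1 (negPf q1).
(* If [p] divides [B], it divides [A] as well, so [p(X^2)] divides [q], against the degrees. *)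
have [pB|pB] := boolP (p %| B).
  have pA : p %| A.
    apply: contraLR (dvdp_add pN (dvdp_mull 'X (dvdp_exp (isT : 0 < 2)%N pB))).
    by move=> pA; rewrite /N subrK -irreducible_poly_coprime // coprimep_expr //
      irreducible_poly_coprime.
  have : p \Po 'X^2 %| q by rewrite qE dvdp_add ?dvdp_mulr ?dvdp_comp_poly.
  by move/dvdp_leq => /(_ q0); rewrite leqNgt lt_qp.
have /Bezout_eq1_coprimepP[[u v] /= uv] : coprimep p B.
  by rewrite irreducible_poly_coprime.
apply/negP: (nsq (A * v)); rewrite negbK.
have -> : 'X - (A * v) ^+ 2 = (u * p) * (1 + v * B) * 'X - v ^+ 2 * N.
  by have -> : u * p = 1 - v * B; [rewrite -uv addrK | rewrite /N; ring].
by rewrite dvdp_sub ?(dvdp_mull _ pN) // -mulrA dvdp_mulr ?dvdp_mull.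
Qed.

(* If [s] is a square root of [X] modulo [f(X^4)], comparing even and odd parts
   gives [X = - w^2] modulo [f(X^2)]; the substitution [X -> -X] preserves
   [f(X^2)] and turns this into a square root of [X] modulo [f(X^2)]. *)
Lemma irreducible_comp_X8 (F : fieldType) (f : {poly F}) :
  irreducible_poly (f \Po 'X^4) -> irreducible_poly (f \Po 'X^8).
Proof.
set g := f \Po 'X^2.
have -> : f \Po 'X^4 = g \Po 'X^2.
  by rewrite -comp_polyA comp_Xn_poly -exprM.
have -> : f \Po 'X^8 = (g \Po 'X^2) \Po 'X^2.
  by rewrite -!comp_polyA !comp_Xn_poly -!exprM.
move=> irr; apply: irreducible_comp_X2 => // s; apply/negP.
have g1 : ~~ (g %| 1).
  have := (irreducible_comp (q := 'X^2) _ irr).1.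
  by rewrite size_polyXn dvdp1 => /(_ isT); case: (size g) => [|[|]].
rewrite -[s]poly_even_odd; set A := even_poly s; set B := odd_poly s.
have -> : 'X - (A \Po 'X^2 + (B \Po 'X^2) * 'X) ^+ 2 =
    ((- (A ^+ 2 + 'X * B ^+ 2)) \Po 'X^2) + ((1 - 2 * A * B) \Po 'X^2) * 'X.
  rewrite !rmorphB rmorphN !rmorphD !rmorphM /= comp_polyX rmorph1 ?rmorphXn /=.
  have -> : (2 : {poly F}) \Po 'X^2 = 2 by rewrite rmorph_nat.
  ring.
case/dvdp_comp_X2/andP; rewrite dvdpNr => gA gB.
(* Modulo [g], multiply [A^2 + X B^2 = 0] by [4 A^2] and use [2 A B = 1]. *)
pose w := 2 * A ^+ 2.
have gw : g %| 'X + w ^+ 2.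
  have -> : 'X + w ^+ 2 = (1 - 2 * A * B) * ((1 + 2 * A * B) * 'X) +
      (A ^+ 2 + 'X * B ^+ 2) * (4 * A ^+ 2) by rewrite /w; ring.
  by rewrite dvdp_add ?dvdp_mulr.
(* Modulo [g], [X] is the square of [w(-X)]; putting [X^2] for [X] gives [X^2 = t^2] modulo
   [g(X^2)], a difference of squares. *)
pose t := (w \Po - 'X) \Po 'X^2.
have : g \Po 'X^2 %| ('X - t) * ('X + t).
  rewrite -dvdpNr.
  have -> : - (('X - t) * ('X + t)) = ('X + w ^+ 2) \Po - 'X \Po 'X^2.
    by rewrite !rmorphD !rmorphXn /= comp_polyX rmorphN /= comp_polyX -/t; ring.
  by rewrite -[g](comp_X2_oppX f) !dvdp_comp_poly.
(* Since [t] is even, [X - t] and [X + t] have odd part 1, which [g] does not divide; so the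
   irreducible [g(X^2)] divides neither factor. *)
have no u : ~~ (g \Po 'X^2 %| u \Po 'X^2 + 'X).
  apply/negP; rewrite -[X in _ + X]mul1r -[X in _ + X * _](comp_polyC 1 'X^2).
  by case/dvdp_comp_X2/andP => _; apply/negP.
have no1 : ~~ (g \Po 'X^2 %| 'X - t).
  by rewrite addrC /t -rmorphN; apply: no.
have no2 : ~~ (g \Po 'X^2 %| 'X + t) by rewrite addrC; apply: no.
by apply/negP; rewrite Gauss_dvdpr // irreducible_poly_coprime.
Qed.

(** Induction runs over the exponents [2^(m+2)], passing from [X^4] to [X^8] for [f(X^(2^m))];
    stripping an inner [X^4] then reaches [2^m]. *)
Lemma irreducible_comp_X2n (F : fieldType) (f : {poly F}) :
  irreducible_poly (f \Po 'X^4) -> forall m, irreducible_poly (f \Po 'X^(2 ^ m)).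
Proof.
move=> irr m.
have irr2 : irreducible_poly (f \Po 'X^(2 ^ m.+2)).
  elim: m => // m; pose g := f \Po 'X^(2 ^ m).
  have gE k : f \Po 'X^(2 ^ (k + m)) = g \Po 'X^(2 ^ k).
    by rewrite -comp_polyA comp_Xn_poly -exprM -expnD.
  by rewrite (gE 2) (gE 3); apply: irreducible_comp_X8.
apply: (@irreducible_comp _ _ 'X^4); first by rewrite size_polyXn.
by rewrite -comp_polyA comp_Xn_poly -exprM -(expnD 2 2).
Qed.

(** * Evaluation at [r n] and denominators in [D] *)

Lemma substM (F L : fieldType) (iota : {rmorphism F -> L}) (p q : {poly F}) x :
  subst iota (p * q) x = subst iota p x * subst iota q x.
Proof. by rewrite /subst rmorphM hornerM. Qed.

Lemma substD (F L : fieldType) (iota : {rmorphism F -> L}) (p q : {poly F}) x :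
  subst iota (p + q) x = subst iota p x + subst iota q x.
Proof. by rewrite /subst rmorphD hornerD. Qed.

Lemma substXn (F L : fieldType) (iota : {rmorphism F -> L}) n x :
  subst iota 'X^n x = x ^+ n.
Proof. by rewrite /subst map_polyXn hornerXn. Qed.

Lemma substC (F L : fieldType) (iota : {rmorphism F -> L}) c x :
  subst iota c%:P x = iota c.
Proof. by rewrite /subst map_polyC hornerC. Qed.

Lemma subst_comp (F L : fieldType) (iota : {rmorphism F -> L})
    (p q : {poly F}) x :
  subst iota (p \Po q) x = subst iota p (subst iota q x).
Proof. by rewrite /subst map_comp_poly horner_comp. Qed.

Lemma horner2_inv_num (F L : fieldType) (iota : {rmorphism F -> L}) (x : L)
    (p : {poly {poly F}}) : x != 0 ->
  exists j q, (map_poly (map_poly iota) p).[x, x^-1] * x ^+ j = subst iota q x.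
Proof.
move=> x0.
(* The inner variable is evaluated at [x^-1], so the denominators of the coefficients are cleared
   first. *)
have coef (c : {poly F}) : exists j q, subst iota c x^-1 * x ^+ j = subst iota q x.
  elim/poly_ind: c => [|c k [j [q e]]].
    by exists 0%N, 0; rewrite /subst !rmorph0 !horner0 mul0r.
  exists j.+1, (q + k *: 'X^(j.+1)); rewrite /subst.
  rewrite rmorphD /= rmorphM /= map_polyX map_polyC hornerMXaddC.
  rewrite rmorphD /= map_polyZ map_polyXn hornerD hornerZ hornerXn /=.
  by rewrite mulrDl exprS mulrA mulfVK // -/(subst iota c _) e.
elim/poly_ind: p => [|p c [i [s e]]].
  by exists 0%N, 0; rewrite /subst !rmorph0 !horner0 mul0r.
have [j [t e']] := coef c.
exists (i + j)%N, (s * 'X^(j.+1) + t * 'X^i).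
rewrite substD !substM !substXn -e -e'.
rewrite rmorphD /= rmorphM /= map_polyX map_polyC hornerMXaddC hornerD hornerM.
by rewrite /= hornerC -/(subst iota c _) exprD exprS; ring.
Qed.

Lemma DringP (F L : fieldType) (iota : {rmorphism F -> L}) (r : nat -> L) n z :
  r n != 0 ->
  Dring iota r n z <-> exists j p, z * r n ^+ j = subst iota p (r n).
Proof.
move=> x0; split=> [[p ->]|[j [p e]]]; first exact: horner2_inv_num.
(* The outer variable goes to [r n] and the inner one to its inverse, so this evaluates to
   [p(r n) / r n ^+ j]. *)
exists (map_poly polyC p * ('X^j)%:P).
rewrite rmorphM /= map_polyC hornerM hornerC hornerM /= map_polyXn hornerXn.
have -> : map_poly (map_poly iota) (map_poly polyC p)
        = map_poly polyC (map_poly iota p).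
  by rewrite -!map_poly_comp; apply: eq_map_poly => c /=; rewrite map_polyC.
by rewrite horner_map hornerC -/(subst _ _ _) -e exprVn mulfK ?expf_neq0.
Qed.

Lemma root_tower_neq0 (F L : fieldType) (iota : {rmorphism F -> L})
    (r : nat -> L) : root_tower iota r -> forall n, r n != 0.
Proof.
case=> tr r2; elim=> [|n IHn].
  by apply/eqP => r0; case: tr; rewrite r0; apply: algebraic0.
by apply: contraNneq IHn => r0; rewrite -r2 r0 expr0n.
Qed.

Lemma root_tower_exp (F L : fieldType) (iota : {rmorphism F -> L})
    (r : nat -> L) : root_tower iota r -> forall m n, r (m + n)%N ^+ (2 ^ m) = r n.
Proof.
case=> _ r2 m n; elim: m => [|m IHm]; first exact: expr1.
by rewrite expnS exprM r2.
Qed.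

Lemma subst_level (F L : fieldType) (iota : {rmorphism F -> L})
    (r : nat -> L) : root_tower iota r -> forall m n p,
  subst iota (p \Po 'X^(2 ^ m)) (r (m + n)%N) = subst iota p (r n).
Proof.
by move=> hr m n p; rewrite subst_comp substXn (root_tower_exp hr).
Qed.

(** A nonzero polynomial vanishing at [r n] would make [r n] algebraic, and with it its power
    [r 0]. *)
Lemma subst_inj (F L : fieldType) (iota : {rmorphism F -> L})
    (r : nat -> L) : root_tower iota r -> forall n,
  injective (fun p => subst iota p (r n)).
Proof.
move=> hr n p q /eqP; rewrite -subr_eq0 /subst -hornerN -hornerD -rmorphB => pq.
apply/eqP; rewrite -subr_eq0; apply/negPn/negP => pq0.
have alg_n : algebraicOver iota (r n) by exists (p - q).
case: hr.1; rewrite -(root_tower_exp hr n 0) addn0.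
elim: (2 ^ n)%N => [|k IHk]; first exact: algebraic1.
by rewrite exprS; apply: algebraic_mul.
Qed.

(** Allowing every level above [n] lets finitely many elements of [D] be written at one common
    level. *)
Lemma Dunion_num (F L : fieldType) (iota : {rmorphism F -> L})
    (r : nat -> L) : root_tower iota r -> forall z, Dunion iota r z ->
  exists n, forall m, (n <= m)%N ->
    exists j p, z * r m ^+ j = subst iota p (r m).
Proof.
move=> hr z [n /(DringP _ _ (root_tower_neq0 hr n)) [j [p e]]].
exists n => m /subnK <-; exists (2 ^ (m - n) * j)%N, (p \Po 'X^(2 ^ (m - n))).
by rewrite exprM (root_tower_exp hr) e (subst_level hr).
Qed.

Lemma Dunion_den (F L : fieldType) (iota : {rmorphism F -> L})
    (r : nat -> L) : root_tower iota r -> forall n j p z,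
  z * r n ^+ j = subst iota p (r n) -> Dunion iota r z.
Proof.
move=> hr n j p z e; exists n; apply/(DringP _ _ (root_tower_neq0 hr n)).
by exists j, p.
Qed.

Lemma Dunion_subst (F L : fieldType) (iota : {rmorphism F -> L})
    (r : nat -> L) : root_tower iota r -> forall n p,
  Dunion iota r (subst iota p (r n)).
Proof. by move=> hr n p; apply: (@Dunion_den _ _ _ _ hr n 0 p); rewrite mulr1. Qed.

Lemma Dunion1 (F L : fieldType) (iota : {rmorphism F -> L})
    (r : nat -> L) : root_tower iota r -> Dunion iota r 1.
Proof.
by move=> hr; have := Dunion_subst hr 0 1%:P; rewrite substC rmorph1.
Qed.

Lemma DunionM (F L : fieldType) (iota : {rmorphism F -> L})
    (r : nat -> L) : root_tower iota r -> forall a b,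
  Dunion iota r a -> Dunion iota r b -> Dunion iota r (a * b).
Proof.
move=> hr a b /(Dunion_num hr)[m Ha] /(Dunion_num hr)[n Hb].
have [i [p ep]] := Ha _ (leq_maxl m n); have [j [q eq]] := Hb _ (leq_maxr m n).
apply: (@Dunion_den _ _ _ _ hr (maxn m n) (i + j) (p * q)).
by rewrite substM -ep -eq exprD; ring.
Qed.

(** * Units, irreducible elements and prime elements *)

Lemma prime_in_irreducible_in (A : comNzRingType) (S : A -> Prop) (a : A) :
  S 1 -> (forall x, a * x = a -> x = 1) -> prime_in S a -> irreducible_in S a.
Proof.
move=> S1 reg [Sa a0 aU pr]; split=> // b c Sb Sc abc.
have : dvd_in S a (b * c) by exists 1; rewrite ?mulr1.
case/(pr b c Sb Sc) => [[d Sd bE]|[d Sd cE]]; [right|left]; split=> //.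
  by exists d => //; apply: reg; rewrite [in RHS]abc bE; ring.
by exists d => //; apply: reg; rewrite [in RHS]abc cE; ring.
Qed.

Lemma irreducible_inM_unit (A : comNzRingType) (S : A -> Prop) (a u : A) :
  (forall x y, S x -> S y -> S (x * y)) ->
  unit_in S u -> irreducible_in S a -> irreducible_in S (a * u).
Proof.
move=> SM [Su [v Sv uv]] [Sa a0 aU irr]; split; first exact: SM.
- by move=> au0; apply: a0; rewrite -[a]mulr1 -uv mulrA au0 mul0r.
- case=> _ [w Sw auw]; apply: aU; split=> //.
  by exists (u * w); [apply: SM | rewrite mulrA].
move=> b c Sb Sc e; have Scv := SM _ _ Sc Sv.
have /irr[] // : a = b * (c * v) by rewrite mulrA -e -mulrA uv mulr1.
  by left.
case=> _ [w Sw cvw]; right; split=> //.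
by exists (v * w); [apply: SM | rewrite mulrA].
Qed.

(** Clearing the denominator of an inverse gives [p' * q = 'X^j] at a higher level; [p'] is coprime
    to [X], hence constant. *)
Lemma unit_in_Dunion_subst (F L : fieldType) (iota : {rmorphism F -> L})
    (r : nat -> L) : root_tower iota r -> forall n p, p.[0] != 0 ->
  unit_in (Dunion iota r) (subst iota p (r n)) <-> size p = 1%N.
Proof.
move=> hr n p p0; split=> [[_ [v /(Dunion_num hr)[m /(_ _ (leq_addr n m))]]]|].
  case=> j [q e] pv; set p' := p \Po 'X^(2 ^ m).
  have p'q : p' * q = 'X^j.
    apply: (subst_inj hr (n := m + n)).
    by rewrite /= substM (subst_level hr) -e mulrA pv mul1r substXn.
  have cop : coprimep p' 'X^j.
    rewrite coprimep_expr // coprimepX root_comp hornerXn expr0n.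
    by rewrite expn_eq0.
  have : p' %| 1.
    by rewrite -(Gauss_dvdpr _ cop) mulr1 -p'q dvdp_mulr.
  rewrite dvdp1 => /eqP s1.
  have := size_comp_poly p 'X^(2 ^ m); rewrite -/p' s1 size_polyXn => /esym/eqP.
  rewrite muln_eq0 expn_eq0 orbF; case: (size p) (size_poly_eq0 p) => [/esym/eqP|].
    by move=> p00; rewrite p00 horner0 eqxx in p0.
  by case.
move/eqP/size_poly1P => [c c0 ->]; split; first exact: Dunion_subst.
exists (subst iota (c^-1)%:P (r n)); first exact: Dunion_subst.
by rewrite !substC -rmorphM mulfV // rmorph1.
Qed.

(** A factorization of [f(X^(2^m))] is one in [D] at level [m + n]; its factors keep nonzero
    constant terms, so those that are units of [D] are constants. *)
Lemma irreducible_in_Dunion_comp (F L : fieldType) (iota : {rmorphism F -> L})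
    (r : nat -> L) : root_tower iota r -> forall n m f, f.[0] != 0 ->
  irreducible_in (Dunion iota r) (subst iota f (r n)) ->
  irreducible_poly (f \Po 'X^(2 ^ m)).
Proof.
move=> hr n m f f0; rewrite -(subst_level hr m); set p := f \Po _.
have p0 : p.[0] != 0.
  by rewrite /p horner_comp hornerXn expr0n expn_eq0.
case=> _ _ pU irr.
have s1 : size p <> 1%N by move/(unit_in_Dunion_subst hr (m + n) p0).
have pn0 : p != 0 by apply: contraNneq p0 => ->; rewrite horner0.
split=> [|q q1 /dvdpP[c e]].
  by case: (size p) s1 (size_poly_eq0 p) => [|[]] //; rewrite (negPf pn0).
move: p0; rewrite e hornerM mulf_eq0 negb_or => /andP[c0 q0].
case: (irr (subst iota c (r (m + n)%N)) (subst iota q (r (m + n)%N))).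
- exact: Dunion_subst.
- exact: Dunion_subst.
- by rewrite e substM.
- move/(unit_in_Dunion_subst hr (m + n) c0)/eqP/size_poly1P => [k k0 ->].
  by rewrite mul_polyC eqp_sym eqp_scale.
- by move/(unit_in_Dunion_subst hr (m + n) q0) => sq; rewrite sq in q1.
Qed.

Lemma prime_in_Dunion (F L : fieldType) (iota : {rmorphism F -> L})
    (r : nat -> L) : root_tower iota r -> forall k f, f.[0] != 0 ->
  (forall m, irreducible_poly (f \Po 'X^(2 ^ m))) ->
  prime_in (Dunion iota r) (subst iota f (r k)).
Proof.
move=> hr k f f0 irr; have irr0 := irr 0%N; rewrite comp_polyXr in irr0.
split=> [||/(unit_in_Dunion_subst hr k f0) s1|b c Db Dc [d Dd bc]].
- exact: Dunion_subst.
- have e0 : subst iota 0 (r k) = 0 by rewrite substC rmorph0.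
  by rewrite -{}e0 => /(subst_inj hr) f00; rewrite f00 horner0 eqxx in f0.
- by have := irr0.1; rewrite s1.
have [n1 H1] := Dunion_num hr Db; have [n2 H2] := Dunion_num hr Dc.
have [n3 H3] := Dunion_num hr Dd.
(* At level [N], which lies above [k], all of [b], [c], [d] have polynomial numerators. *)
pose m := (n1 + n2 + n3)%N; pose N := (m + k)%N.
have [i [p ep]] : exists j p, b * r N ^+ j = subst iota p (r N).
  by apply: H1; rewrite /N /m -!addnA leq_addr.
have [j [q eq]] : exists j p, c * r N ^+ j = subst iota p (r N).
  by apply: H2; rewrite /N /m -!addnA addnCA leq_addr.
have [l [s es]] : exists j p, d * r N ^+ j = subst iota p (r N).
  by apply: H3; rewrite /N /m addnAC leq_addl.
set g := f \Po 'X^(2 ^ m).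
have gE : subst iota f (r k) = subst iota g (r N) by rewrite (subst_level hr).
have e : p * q * 'X^l = g * s * 'X^(i + j).
  apply: (subst_inj hr (n := N)); rewrite /= !substM !substXn -ep -eq -es -gE.
  have -> : b * r N ^+ i * (c * r N ^+ j) * r N ^+ l =
      b * c * r N ^+ i * r N ^+ j * r N ^+ l by ring.
  by rewrite bc exprD; ring.
have dvd_num z t h : z * r N ^+ h = subst iota t (r N) -> g %| t ->
    dvd_in (Dunion iota r) (subst iota f (r k)) z.
  move=> ez /dvdpP[w tw].
  have rN0 : r N ^+ h != 0 by rewrite expf_neq0 // (root_tower_neq0 hr).
  exists (subst iota w (r N) / r N ^+ h).
    by apply: (@Dunion_den _ _ _ _ hr N h w); rewrite divfK.
  by rewrite gE mulrA -substM mulrC -[RHS]mulrC [g * w]mulrC -tw -ez mulfK.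
(* The power of [X] left by the denominators can be cancelled because [g(0)] is nonzero. *)
have cop : coprimep g 'X^l.
  by rewrite coprimep_expr // coprimepX root_comp hornerXn expr0n expn_eq0.
have : g %| p * q.
  by rewrite -(Gauss_dvdpl _ cop) e -mulrA dvdp_mulr.
have [gp _|gp] := boolP (g %| p); first by left; apply: dvd_num ep gp.
rewrite Gauss_dvdpr ?(irreducible_poly_coprime _ (irr m)) // => gq.
by right; apply: dvd_num eq gq.
Qed.

(** Powers of [r n] are units of [D]: clearing the denominator of [a] and stripping the powers of
    [X] from its numerator yields an associate of [a]. *)
Lemma irreducible_in_Dunion_assoc (F L : fieldType) (iota : {rmorphism F -> L})
    (r : nat -> L) : root_tower iota r -> forall a,
  irreducible_in (Dunion iota r) a ->
  exists n f, f.[0] != 0 /\ irreducible_in (Dunion iota r) (subst iota f (r n)).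
Proof.
move=> hr a irr; have [Da a0 _ _] := irr.
have [n /(_ n (leqnn n)) [j [p e]]] := Dunion_num hr Da.
have x0 := root_tower_neq0 hr n.
have [k [f fX pE]] := multiplicity_XsubC p 0.
have p0 : p != 0.
  apply: contraPneq a0 => p0; have : a * r n ^+ j == 0.
    by rewrite e p0 substC rmorph0.
  by rewrite mulf_eq0 expf_eq0 (negPf x0) andbF orbF => /eqP-> /(_ erefl).
exists n, f; split; first by move: fX; rewrite p0.
have -> : subst iota f (r n) = a * (r n ^+ j / r n ^+ k).
  by rewrite mulrA e pE subr0 substM substXn mulfK ?expf_neq0.
apply: irreducible_inM_unit irr; first exact: DunionM.
have D i i' : Dunion iota r (r n ^+ i / r n ^+ i').
  apply: (@Dunion_den _ _ _ _ hr n i' 'X^i).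
  by rewrite divfK ?expf_neq0 // substXn.
split; first exact: D.
exists (r n ^+ k / r n ^+ j); first exact: D.
by field; rewrite !expf_neq0.
Qed.

Theorem lemma4p6 (F L : fieldType) (iota : {rmorphism F -> L}) (r : nat -> L)
    (hr : root_tower iota r) :
  let D := Dunion iota r in
  (forall (n : nat) (f : {poly F}),
    irreducible_in (Rring iota r n) (subst iota f (r n)) ->
    f.[0] != 0 ->
    [<-> prime_in D (subst iota f (r n));
         irreducible_in D (subst iota f (r n));
         irreducible_poly (f \Po 'X^4);
         forall k : nat, prime_in D (subst iota f (r k))]) /\
  ((forall a : L, ~ irreducible_in D a) <->
   (forall f : {poly F}, irreducible_poly f ->
      ~ irreducible_poly (f \Po 'X^4))).
Proof.
move=> D.
have prime_irr n f : prime_in D (subst iota f (r n)) ->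
    irreducible_in D (subst iota f (r n)).
  move=> pr; have [_ /eqP a0 _ _] := pr.
  apply: prime_in_irreducible_in pr; first exact: Dunion1.
  by move=> x; rewrite -[RHS]mulr1 => /(mulfI a0).
(* Here [f(0) != 0] is derived from the irreducibility of [f(X^4)], as the last equivalence
   requires. *)
have irr_prime f : irreducible_poly (f \Po 'X^4) ->
    forall k, prime_in D (subst iota f (r k)).
  move=> irr k; apply: prime_in_Dunion => //.
    exact: irreducible_comp_Xn_neq0 irr.
  exact: irreducible_comp_X2n.
split=> [n f _ f0|].
  tfae=> [|irr||pr]; [exact: prime_irr | | exact: irr_prime | exact: pr].
  exact: (irreducible_in_Dunion_comp hr 2 f0 irr).
split=> [noirr f _ irr|noirr a /(irreducible_in_Dunion_assoc hr)].
  exact: (noirr (subst iota f (r 0%N)) (prime_irr _ _ (irr_prime _ irr _))).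
(* Taking [m = 0] and [m = 2] makes both [f] and [f(X^4)] irreducible. *)
case=> n [f [f0 irr]]; have irr_comp := irreducible_in_Dunion_comp hr _ f0 irr.
by apply: (noirr f _ (irr_comp 2%N)); have := irr_comp 0%N; rewrite comp_polyXr.
Qed.
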